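(* Let $m\ge1$ and let $\phi:[0,1]^m\to[0,1]^m$ be a Lipschitz continuous map with partial Lipschitz constants $L_\phi^{(l)}$, $l=1,\dots,m$; let $\mathcal{K}f=f\circ\phi$ be the associated Koopman operator on $C([0,1]^m)$. Then, for any $f\in C([0,1]^m)$ and any $\mathbf{n}=(n_1,\dots,n_m)$ with positive integer entries, $$\|\mathcal{B}_\mathbf{n}\mathcal{K}f-\mathcal{K}f\|_{\infty}\leq\frac{3}{2}\sum_{l=1}^m\left.\Omega_f\left(\frac{L_\phi^{(l)}}{\sqrt{n_l}}\right)\right|_{\phi([0,1]^m)}.$$
   Context: $C([0,1]^m)$ is the space of continuous complex-valued functions on $[0,1]^m$, with $\|f\|_\infty=\sup_{\mathbf{x}\in[0,1]^m}|f(\mathbf{x})|$; $\|\cdot\|$ is the Euclidean norm on $\mathbb{R}^m$. The Bernstein operator $\mathcal{B}_\mathbf{n}:C([0,1]^m)\to C([0,1]^m)$ is $$(\mathcal{B}_\mathbf{n}f)(\mathbf{x})=\mathcal{B}_\mathbf{n}(f;\mathbf{x})=\sum_{k_1=0}^{n_1}\cdots\sum_{k_m=0}^{n_m} f\left(\tfrac{k_1}{n_1},\dots,\tfrac{k_m}{n_m}\right)\prod_{l=1}^m b_{n_l,k_l}(x_l),\qquad b_{n,k}(x)=\binom{n}{k}x^k(1-x)^{n-k}.$$ A partial Lipschitz constant $L_\phi^{(l)}\ge0$ of $\phi$ is a real number such that $\|\phi(\mathbf{x})-\phi(\mathbf{y})\|\le L_\phi^{(l)}|x_l-y_l|$ for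 all $\mathbf{x},\mathbf{y}\in[0,1]^m$ that differ only in their $l$th coordinate. For $A\subseteq[0,1]^m$ and $\delta\ge0$, the full modulus of continuity of $f$ evaluated over $A$ is $\Omega_f(\delta)|_A=\sup\{|f(\mathbf{x})-f(\mathbf{y})|:\mathbf{x},\mathbf{y}\in A,\ \|\mathbf{x}-\mathbf{y}\|\le\delta\}$. *)

(* Defs.v *)
From HB Require Import structures.
From mathcomp Require Export all_boot all_order all_algebra.
From mathcomp Require Export complex.
From mathcomp Require Export all_classical all_reals all_analysis.

Set Implicit Arguments.
Unset Strict Implicit.
Unset Printing Implicit Defensive.

Export Order.TTheory GRing.Theory Num.Theory.
Export numFieldNormedType.Exports.

Local Open Scope classical_set_scope.
Local Open Scope ring_scope.
Local Open Scope complex_scope.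

Definition unit_cube (R : realType) (m : nat) : set 'rV[R]_m :=
  [set x | forall l : 'I_m, 0 <= x ord0 l <= 1].
Arguments unit_cube : clear implicits.

(* The library norm [`|x|] on ['rV[R]_m] is the max norm. *)
Definition euclidean_norm (R : realType) (m : nat) (x : 'rV[R]_m) : R :=
  Num.sqrt (\sum_(l < m) x ord0 l ^+ 2).

(* Functions on the cube are total functions on ['rV[R]_m], of which only the
   restriction to the cube matters. The regular algebra [R[i]^o] is what
   carries the topology given by the complex modulus. *)
Definition cube_continuous (R : realType) (m : nat)
    (f : 'rV[R]_m -> R[i]) : Prop :=
  {within unit_cube R m, continuous (f : 'rV[R]_m -> R[i]^o)}.

(* The suprema below are real-valued; [sup] is the least upper bound of a
   nonempty bounded set, and 0 on other sets. [normc] is the complex modulus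
   as an element of [R] (the library's [`|z|] lives in [R[i]]). *)
Definition cube_supnorm (R : realType) (m : nat) (f : 'rV[R]_m -> R[i]) : R :=
  sup [set ComplexField.Normc.normc (f x) | x in unit_cube R m].

Definition full_modulus (R : realType) (m : nat) (A : set 'rV[R]_m)
    (f : 'rV[R]_m -> R[i]) (delta : R) : R :=
  sup [set r | exists x y : 'rV[R]_m,
    [/\ A x, A y, euclidean_norm (x - y) <= delta &
        r = ComplexField.Normc.normc (f x - f y)]].

Definition cube_lipschitz (R : realType) (m : nat)
    (phi : 'rV[R]_m -> 'rV[R]_m) : Prop :=
  exists K : R, forall x y : 'rV[R]_m, unit_cube R m x -> unit_cube R m y ->
    euclidean_norm (phi x - phi y) <= K * euclidean_norm (x - y).

Definition partial_lipschitz_const (R : realType) (m : nat)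
    (phi : 'rV[R]_m -> 'rV[R]_m) (l : 'I_m) (L : R) : Prop :=
  0 <= L /\
  forall x y : 'rV[R]_m, unit_cube R m x -> unit_cube R m y ->
    (forall j : 'I_m, j != l -> x ord0 j = y ord0 j) ->
    euclidean_norm (phi x - phi y) <= L * `|x ord0 l - y ord0 l|.

Definition bernstein_basis (R : realType) (n k : nat) (x : R) : R :=
  'C(n, k)%:R * x ^+ k * (1 - x) ^+ (n - k).

(* The iterated sum over 0 <= k_l <= n_l is a single sum over multi-indices,
   i.e. dependent finite functions [k] with [k l : 'I_(n l).+1]. *)
Definition bernstein (R : realType) (m : nat) (n : 'I_m -> nat)
    (f : 'rV[R]_m -> R[i]) (x : 'rV[R]_m) : R[i] :=
  \sum_(k : {dffun forall l : 'I_m, 'I_(n l).+1})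
    f (\row_(l < m) ((k l)%:R / (n l)%:R)) *
    (\prod_(l < m) bernstein_basis (n l) (k l) (x ord0 l))%:C.

Definition koopman (R : realType) (m : nat) (phi : 'rV[R]_m -> 'rV[R]_m)
    (f : 'rV[R]_m -> R[i]) : 'rV[R]_m -> R[i] := f \o phi.

(* Main.v *)
(** Since [phi @` unit_cube] need not be convex, [f] is controlled by pulling
    segments back to the cube: move from [x] to a node [k / n] one coordinate at
    a time, and cut the [l]-th move, of length [t], into [1 + floor (sqrt n_l t)]
    equal steps, each of which [phi] maps to a pair of points at distance at most
    [L_l / sqrt n_l]. As [floor r <= r ^+ 2] for [r >= 0], the expected number
    of steps is at most [1 + n_l Var(k_l / n_l) = 1 + x_l (1 - x_l) <= 5/4]
    under the binomial weights. *)
Require Import Defs.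
From mathcomp Require Import ring lra.

Set Implicit Arguments.
Unset Strict Implicit.
Unset Printing Implicit Defensive.

Local Open Scope classical_set_scope.
Local Open Scope ring_scope.
Local Open Scope complex_scope.

Local Notation normc := ComplexField.Normc.normc.

(** * Binomial weights and their moments *)

Lemma sum_dffun_prod (R : comNzSemiRingType) (I : finType) (T : I -> finType)
    (F : forall i, T i -> R) :
  \sum_(k : {dffun forall i, T i}) \prod_i F i (k i) =
  \prod_i \sum_(j : T i) F i j.
Proof.
(* The type of [k i] varies with [i]; passing through [fprod] to tagged values gives functions into
   one fixed type, where ordinary distributivity applies. *)
rewrite (reindex (@dffun_of_fprod I T)); last first.
  exact/onW_bij/dffun_of_fprod_bij.
under eq_bigr do under eq_bigr do rewrite ffunE.
pose P i := [ffun j => F i j].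
transitivity (\sum_(t : fprod T) \prod_(i in I) P i (t i)).
  by apply: eq_bigr => t _; apply: eq_bigr => i _; rewrite ffunE.
rewrite (@big_fprod R 0 1 *%R +%R I T P).
rewrite -(bigA_distr_big_dep _ (fun i => untag 0 (P i))).
apply: eq_bigr => i _; rewrite -(big_tag (fun i => P i)).
by apply: eq_bigr => j _; rewrite ffunE.
Qed.

(** Conditioning on one of [n.+1] Bernoulli trials: a success shifts [k] by one, a failure leaves
    it. Pascal's rule yields the two terms, and this recursion drives the inductions below. *)
Lemma sum_bernstein_basisS (R : realType) (n : nat) (x : R) (h : nat -> R) :
  \sum_(k < n.+2) bernstein_basis n.+1 k x * h k =
  x * (\sum_(k < n.+1) bernstein_basis n k x * h k.+1) +
  (1 - x) * (\sum_(k < n.+1) bernstein_basis n k x * h k).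
Proof.
rewrite /bernstein_basis big_ord_recl !mulr_sumr.
transitivity ((1 - x) ^+ n.+1 * h 0%N +
  \sum_(k < n.+1) (x * ('C(n, k)%:R * x ^+ k * (1 - x) ^+ (n - k) * h k.+1) +
    'C(n, k.+1)%:R * x ^+ k.+1 * (1 - x) ^+ (n - k) * h k.+1)).
  congr (_ + _); first by rewrite bin0 subn0 expr0 !mul1r.
  apply: eq_bigr => k _; rewrite /= binS natrD subSS exprS; ring.
rewrite big_split /= addrCA; congr (_ + _).
(* The top term carries ['C(n, n.+1) = 0]; the isolated term at [h 0] takes its place. *)
rewrite big_ord_recr /= bin_small // !mul0r addr0 [RHS]big_ord_recl.
congr (_ + _); first by rewrite bin0 subn0 expr0 exprS; ring.
apply: eq_bigr => k _; rewrite lift0.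
by rewrite -(subnSK (ltn_ord k)) [(1 - x) ^+ _.+1]exprS; ring.
Qed.

Lemma sum_bernstein_basis (R : realType) (n : nat) (x : R) :
  \sum_(k < n.+1) bernstein_basis n k x = 1.
Proof.
elim: n => [|n IHn].
  by rewrite big_ord1 /bernstein_basis bin0 !expr0 !mulr1.
under eq_bigr do rewrite -[bernstein_basis _ _ _]mulr1.
rewrite (sum_bernstein_basisS _ _ (fun=> 1)).
by under eq_bigr do rewrite mulr1; rewrite IHn; ring.
Qed.

(** Variance plus squared bias. The centre [c] must stay arbitrary: a success in the recursion turns
    [c] into [c - 1]. *)
Lemma bernstein_basis_moment2 (R : realType) (n : nat) (x c : R) :
  \sum_(k < n.+1) bernstein_basis n k x * (k%:R - c) ^+ 2 =
  n%:R * (x * (1 - x)) + (n%:R * x - c) ^+ 2.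
Proof.
elim: n c => [|n IHn] c.
  by rewrite big_ord1 /bernstein_basis bin0 /= !expr0; ring.
rewrite (sum_bernstein_basisS _ _ (fun k => (k%:R - c) ^+ 2)) IHn.
under eq_bigr => k _.
  have -> : (k : nat).+1%:R - c = k%:R - (c - 1) :> R by rewrite -natr1 opprB addrA.
  over.
rewrite IHn -natr1; ring.
Qed.

Lemma bernstein_basis_variance (R : realType) (n : nat) (x : R) : (0 < n)%N ->
  \sum_(k < n.+1) bernstein_basis n k x * (n%:R * (k%:R / n%:R - x) ^+ 2) =
  x * (1 - x).
Proof.
move=> n0; have nN0 : n%:R != 0 :> R by rewrite pnatr_eq0 -lt0n.
transitivity (n%:R^-1 *
  \sum_(k < n.+1) bernstein_basis n k x * (k%:R - n%:R * x) ^+ 2).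
  by rewrite mulr_sumr; apply: eq_bigr => k _; field.
by rewrite bernstein_basis_moment2; field.
Qed.

Lemma bernstein_basis_ge0 (R : realType) (n k : nat) (x : R) :
  0 <= x <= 1 -> 0 <= bernstein_basis n k x.
Proof.
by case/andP=> x0 x1; rewrite !mulr_ge0 ?exprn_ge0 ?ler0n ?subr_ge0.
Qed.

(** * Product weights on multi-indices *)

Section MultivariateWeights.
Context (R : realType) (m : nat) (n : 'I_m -> nat) (x : 'rV[R]_m).

Local Notation multi_index := {dffun forall l : 'I_m, 'I_(n l).+1}.
Local Notation weight k :=
  (\prod_(l < m) bernstein_basis (n l) (k l) (x ord0 l)).

Lemma sum_bernstein_weight : \sum_(k : multi_index) weight k = 1.
Proof.
rewrite (sum_dffun_prod
  (fun l (i : 'I_(n l).+1) => bernstein_basis (n l) i (x ord0 l))).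
by rewrite big1 // => l _; exact: sum_bernstein_basis.
Qed.

(** The marginals of the product weight are binomial: [h] is absorbed into the factor [j], and every
    other factor sums to 1. *)
Lemma sum_bernstein_weight_coord (j : 'I_m) (h : nat -> R) :
  \sum_(k : multi_index) weight k * h (k j) =
  \sum_(i < (n j).+1) bernstein_basis (n j) i (x ord0 j) * h i.
Proof.
pose F l (i : 'I_(n l).+1) :=
  bernstein_basis (n l) i (x ord0 l) * (if l == j then h i else 1).
transitivity (\sum_(k : multi_index) \prod_l F l (k l)).
  apply: eq_bigr => k _; rewrite /F [RHS]big_split; congr (_ * _).
  by rewrite -big_mkcond big_pred1_eq.
rewrite sum_dffun_prod (bigD1 j) //= [X in _ * X]big1 ?mulr1.
  by apply: eq_bigr => i _; rewrite /F eqxx.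
move=> l /negPf lj; rewrite -[RHS](sum_bernstein_basis (n l) (x ord0 l)).
by apply: eq_bigr => i _; rewrite /F lj mulr1.
Qed.

End MultivariateWeights.

(** * Complex modulus and boundedness on the cube *)

Lemma normc_ge0 (R : realType) (z : R[i]) : 0 <= normc z.
Proof. by case: z => a b; exact: sqrtr_ge0. Qed.

Lemma normc_sum (R : realType) (I : Type) (r : seq I) (P : pred I)
    (F : I -> R[i]) :
  normc (\sum_(i <- r | P i) F i) <= \sum_(i <- r | P i) normc (F i).
Proof.
apply: (big_ind2 (fun z s => normc z <= s)) => // [|z s z' s' zs zs'].
  by rewrite ComplexField.Normc.normc0.
exact: le_trans (le_normcD z z') (lerD zs zs').
Qed.

Lemma normc_real (R : realType) (r : R) : 0 <= r -> normc r%:C = r.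
Proof. by move=> r0; rewrite /= expr0n addr0 sqrtr_sqr ger0_norm. Qed.

Lemma unit_cube_compact (R : realType) (m : nat) : compact (unit_cube R m).
Proof.
have := @rV_compact R m (fun=> `[0, 1]%classic) (fun=> @segment_compact R 0 1).
congr compact; apply/seteqP; split => v /= v01 l; have := v01 l;
  by rewrite in_itv.
Qed.

Lemma ler_normc_dist (R : realType) (z w : R[i]) :
  `|normc z - normc w| <= normc (z - w).
(* [Rcomplex R] is [R[i]] as a real normed space with norm [normc]. *)
Proof. exact: (@ler_dist_dist _ (Rcomplex R) z w). Qed.

(** Compactness of the cube gives the bound, which makes the [sup] in [full_modulus] a true supremum
    rather than the default 0. *)
Lemma cube_continuous_bounded (R : realType) (m : nat)
    (f : 'rV[R]_m -> R[i]) : cube_continuous f ->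
  exists M : R, forall x, unit_cube R m x -> normc (f x) <= M.
Proof.
move=> fc.
have gc : {within unit_cube R m, continuous (fun x => normc (f x) : R^o)}.
  move=> x; apply/cvgrPdist_lt => e e0.
  have := fc x; move/cvgrPdist_lt => /(_ e%:C); rewrite ltcR => /(_ e0).
  apply: filterS => y; rewrite normc_def ltcR => fxy.
  apply: le_lt_trans fxy; apply: le_trans (ler_normc_dist _ _) _.
  by rewrite /from_subspace; case: (f x - f y).
have [M [_ HM]] := compact_bounded
  (continuous_compact gc (@unit_cube_compact R m)).
(* [compact_bounded] provides only the bounds strictly above [M]. *)
exists (M + 1) => x xc.
apply: le_trans (HM (M + 1) _ (normc (f x)) _); first exact: ler_norm.
  by rewrite ltrDl.
by exists x.
Qed.

Section FullModulus.
Context (R : realType) (m : nat) (A : set 'rV[R]_m) (f : 'rV[R]_m -> R[i]).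
Context (M : R) (f_bounded : forall x, A x -> normc (f x) <= M).

Lemma le_full_modulus (d : R) (x y : 'rV[R]_m) : A x -> A y ->
  euclidean_norm (x - y) <= d -> normc (f x - f y) <= full_modulus A f d.
Proof.
move=> Ax Ay xyd; apply: ub_le_sup; last by exists x, y.
exists (M + M) => _ [u [v [Au Av _ ->]]].
apply: le_trans (le_normcD _ _) _.
by rewrite normcN lerD ?f_bounded.
Qed.

Lemma full_modulus_ge0 (d : R) (x : 'rV[R]_m) :
  A x -> 0 <= d -> 0 <= full_modulus A f d.
Proof.
move=> Ax d0; rewrite -(ComplexField.Normc.normc0 R) -(subrr (f x)).
apply: le_full_modulus => //; rewrite subrr /euclidean_norm.
by rewrite big1 ?sqrtr0 // => l _; rewrite mxE expr0n.
Qed.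

End FullModulus.

(** * Increments of [f \o phi] along coordinate moves *)

Section KoopmanIncrement.
Context (R : realType) (m : nat) (phi : 'rV[R]_m -> 'rV[R]_m).
Context (f : 'rV[R]_m -> R[i]) (M : R).
Hypothesis f_bounded :
  forall x, (phi @` unit_cube R m) x -> normc (f x) <= M.

(** The number of steps is bounded by a quadratic in the displacement because the binomial mean of a
    square is known exactly. The scale [s] will be [sqrt n_l]. *)
Lemma koopman_increment (l : 'I_m) (L s : R) (x y : 'rV[R]_m) :
  partial_lipschitz_const phi l L -> 0 < s ->
  unit_cube R m x -> unit_cube R m y ->
  (forall j, j != l -> x ord0 j = y ord0 j) ->
  normc (koopman phi f x - koopman phi f y) <=
    (1 + (s * (x ord0 l - y ord0 l)) ^+ 2) *
    full_modulus (phi @` unit_cube R m) f (L / s).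
Proof.
move=> [L0 phiL] s0 xc yc xy.
set W := full_modulus _ _ _; set t := x ord0 l - y ord0 l.
have W0 : 0 <= W.
  apply: (full_modulus_ge0 f_bounded (x := phi x)); first by exists x.
  by rewrite divr_ge0 // ltW.
(* [N] exceeds [s * |t|], so each of the [N] pieces is shorter than [1 / s]. *)
pose N := (Num.truncn (s * `|t|)).+1.
have st0 : 0 <= s * `|t| by rewrite mulr_ge0 // ltW.
have N0 : 0 < N%:R :> R by rewrite ltr0n.
have stN : s * `|t| < N%:R by exact: truncnS_gt.
pose z (j : nat) := y + (j%:R / N%:R) *: (x - y).
have zc j : (j <= N)%N -> unit_cube R m (z j).
  move=> jN i; have /andP[x0 x1] := xc i; have /andP[y0 y1] := yc i.
  have a0 : 0 <= j%:R / N%:R :> R by rewrite divr_ge0.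
  have a1 : j%:R / N%:R <= 1 :> R by rewrite ler_pdivrMr // mul1r ler_nat.
  rewrite !mxE; set a := j%:R / N%:R in a0 a1 *.
  by apply/andP; split; nra.
have zS j : (j < N)%N ->
    normc (koopman phi f (z j.+1) - koopman phi f (z j)) <= W.
  move=> jN; have zj := zc _ (ltnW jN); have zj1 := zc _ jN.
  apply: (le_full_modulus f_bounded); [by exists (z j.+1)|by exists (z j)|].
  apply: le_trans (phiL _ _ zj1 zj _) _ => [i il|].
    by rewrite !mxE xy // subrr !mulr0.
  have -> : z j.+1 ord0 l - z j ord0 l = t / N%:R.
    by rewrite !mxE -/t -natr1; field; rewrite gt_eqF.
  rewrite ler_wpM2l // normrM normfV (gtr0_norm N0).
  by rewrite ler_pdivrMr // ler_pdivlMl // ltW.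
have -> : koopman phi f x - koopman phi f y =
    \sum_(0 <= j < N) (koopman phi f (z j.+1) - koopman phi f (z j)).
  rewrite (telescope_sumr (fun j => koopman phi f (z j))) // /z.
  rewrite divff ?gt_eqF // mul0r scale0r scale1r addr0.
  by rewrite [y + _]addrC subrK.
rewrite big_mkord; apply: le_trans (normc_sum _ _ _) _.
apply: (@le_trans _ _ (\sum_(j < N) W)).
  by apply: ler_sum => j _; exact: zS.
rewrite sumr_const card_ord -mulr_natl ler_wpM2r //.
rewrite -natr1 addrC lerD2l.
(* floor(r) <= r^2 for every r >= 0 *)
have -> : (s * t) ^+ 2 = (s * `|t|) ^+ 2 by rewrite !exprMn real_normK ?num_real.
have [st1|st1] := ltP (s * `|t|) 1.
  suff /eqP -> : Num.truncn (s * `|t|) == 0%N by exact: sqr_ge0.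
  by rewrite truncn_eq // st0.
apply: (@le_trans _ _ (s * `|t|)); first by rewrite truncn_le.
by rewrite expr2 ler_peMr.
Qed.

Lemma koopman_increment_sum (L s : 'I_m -> R) (x y : 'rV[R]_m) :
  (forall l, partial_lipschitz_const phi l (L l)) -> (forall l, 0 < s l) ->
  unit_cube R m x -> unit_cube R m y ->
  normc (koopman phi f x - koopman phi f y) <=
    \sum_(l < m) (1 + (s l * (x ord0 l - y ord0 l)) ^+ 2) *
      full_modulus (phi @` unit_cube R m) f (L l / s l).
Proof.
move=> phiL s0 xc yc.
(* Hybrid points from [p 0 = y] to [p m = x]: they stay in the cube, and [p j] and [p j.+1] differ
   at most in coordinate [j]. *)
pose p (j : nat) := \row_(l < m) if (l < j)%N then x ord0 l else y ord0 l.
have pc j : unit_cube R m (p j) by move=> l; rewrite mxE; case: ifP.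
have -> : koopman phi f x - koopman phi f y =
    \sum_(0 <= j < m) (koopman phi f (p j.+1) - koopman phi f (p j)).
  rewrite (telescope_sumr (fun j => koopman phi f (p j))) //.
  congr (koopman phi f _ - koopman phi f _); apply/rowP => l.
    by rewrite mxE ltn_ord.
  by rewrite mxE.
rewrite big_mkord; apply: le_trans (normc_sum _ _ _) _.
apply: ler_sum => l _.
apply: le_trans (koopman_increment (phiL l) (s0 l) (pc _) (pc _) _) _.
  move=> j jl; rewrite !mxE ltnS [(j <= l)%N]leq_eqVlt.
  by rewrite -[val j == l]/(j == l) (negPf jl).
by rewrite !mxE ltnSn ltnn.
Qed.

End KoopmanIncrement.

(** * Averaging the increment bound over the nodes *)

Theorem theorem4p4 (R : realType) (m : nat) (m_ge1 : (1 <= m)%N)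
    (phi : 'rV[R]_m -> 'rV[R]_m)
    (phi_cube : forall x, unit_cube R m x -> unit_cube R m (phi x))
    (phi_lip : cube_lipschitz phi)
    (L : 'I_m -> R)
    (L_lip : forall l : 'I_m, partial_lipschitz_const phi l (L l))
    (f : 'rV[R]_m -> R[i]) (f_cont : cube_continuous f)
    (n : 'I_m -> nat) (n_gt0 : forall l : 'I_m, (0 < n l)%N) :
  cube_supnorm (fun x => bernstein n (koopman phi f) x - koopman phi f x)
  <= 3 / 2 * \sum_(l < m)
       full_modulus (phi @` unit_cube R m) f (L l / Num.sqrt (n l)%:R).
Proof.
have [M fM] := cube_continuous_bounded f_cont.
have fphiM x : (phi @` unit_cube R m) x -> normc (f x) <= M.
  by move=> [u uc <-]; exact/fM/phi_cube.
have cube0 : unit_cube R m 0 by move=> l; rewrite mxE lexx ler01.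
pose s l : R := Num.sqrt (n l)%:R.
have s0 l : 0 < s l by rewrite sqrtr_gt0 ltr0n.
pose W l := full_modulus (phi @` unit_cube R m) f (L l / s l).
have W0 l : 0 <= W l.
  apply: (full_modulus_ge0 fphiM (x := phi 0)); first by exists 0.
  by case: (L_lip l) => L0 _; rewrite divr_ge0 // ltW.
apply: ge_sup; first by eexists; exists 0.
move=> _ [x xc <-].
pose w (k : {dffun forall l : 'I_m, 'I_(n l).+1}) :=
  \prod_(l < m) bernstein_basis (n l) (k l) (x ord0 l).
have w0 k : 0 <= w k.
  by apply: prodr_ge0 => l _; exact/bernstein_basis_ge0/xc.
pose node (k : {dffun forall l : 'I_m, 'I_(n l).+1}) : 'rV[R]_m :=
  \row_(l < m) ((k l)%:R / (n l)%:R).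
have nodec k : unit_cube R m (node k).
  move=> l; rewrite mxE divr_ge0 //= ler_pdivrMr ?ltr0n //.
  by rewrite mul1r ler_nat -ltnS.
(* Since the weights sum to 1, the value at [x] can be moved inside the sum. *)
have -> : bernstein n (koopman phi f) x - koopman phi f x =
    \sum_k (koopman phi f (node k) - koopman phi f x) * (w k)%:C.
  under [RHS]eq_bigr do rewrite mulrBl.
  rewrite sumrB -mulr_sumr -rmorph_sum.
  by rewrite sum_bernstein_weight rmorph1 mulr1.
apply: le_trans (normc_sum _ _ _) _.
apply: (@le_trans _ _ (\sum_k \sum_(l < m)
    w k * (1 + (n l)%:R * ((k l)%:R / (n l)%:R - x ord0 l) ^+ 2) * W l)).
  apply: ler_sum => k _.
  rewrite ComplexField.Normc.normcM normc_real // mulrC.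
  under eq_bigr do rewrite -mulrA.
  rewrite -mulr_sumr ler_wpM2l //.
  apply: le_trans (koopman_increment_sum fphiM L_lip s0 (nodec k) xc) _.
  by apply: ler_sum => l _; rewrite exprMn sqr_sqrtr // mxE.
(* With the sum over [k] innermost, each [W l] is multiplied by an expectation depending on
   coordinate [l] alone. *)
rewrite exchange_big mulr_sumr; apply: ler_sum => l _ /=.
rewrite -mulr_suml ler_wpM2r //.
under eq_bigr do rewrite mulrDr mulr1.
rewrite big_split /= sum_bernstein_weight.
rewrite (sum_bernstein_weight_coord n x l
  (fun i => (n l)%:R * (i%:R / (n l)%:R - x ord0 l) ^+ 2)).
rewrite bernstein_basis_variance //.
(* The square gives [x_l (1 - x_l) <= 1/4], so the factor is at most [5/4 <= 3/2]. *)
by have := sqr_ge0 (x ord0 l - 1 / 2); nra.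
Qed.
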